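(* Let $\mathbf X\in\mathbb R^d$ be elliptical with positive definite covariance $\boldsymbol\Sigma=\mathbf V\boldsymbol\Lambda\mathbf V'$, $\mathbf Y=\mathbf V'\mathbf X$, and $\alpha\in(0,1)$. Let $\mathcal P$ be the set of $d\times d$ orthogonal matrices; for $\mathbf P\in\mathcal P$ put $\tilde{\mathbf Y}=\mathbf P\mathbf X=(\tilde Y_1,\dots,\tilde Y_d)$. Then for each $i\in\{1,\dots,d\}$, $$\max_{\mathbf P\in\mathcal P}\mathrm{Tr}\,\mathrm{Cov}\big(\tilde{\mathbf Y}\mid\tilde Y_i\in\mathsf T^\alpha_{\tilde Y_i}\big)=\mathrm{Tr}\,\mathrm{Cov}\big(\mathbf Y\mid Y_d\in\mathsf T^\alpha_{Y_d}\big),$$ $$\min_{\mathbf P\in\mathcal P}\mathrm{Tr}\,\mathrm{Cov}\big(\tilde{\mathbf Y}\mid\tilde Y_i\in\mathsf T^\alpha_{\tilde Y_i}\big)=\mathrm{Tr}\,\mathrm{Cov}\big(\mathbf Y\mid Y_1\in\mathsf T^\alpha_{Y_1}\big).$$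
   Context: A random vector $\mathbf X\in\mathbb R^d$ belongs to the elliptical family with parameters $(\boldsymbol\mu,\boldsymbol\Sigma,\phi)$ if its characteristic function is $\mathbb E[e^{i\mathbf t'\mathbf X}]=e^{i\mathbf t'\boldsymbol\mu}\phi(\mathbf t'\boldsymbol\Sigma\mathbf t)$ for all $\mathbf t\in\mathbb R^d$, for some scalar function $\phi$; here $\mathbf X$ is assumed to have finite second moments and covariance matrix $\boldsymbol\Sigma$, positive definite, and the conditioning events have positive probability. Spectral decomposition: $\boldsymbol\Sigma=\mathbf V\boldsymbol\Lambda\mathbf V'$ with $\mathbf V$ orthogonal (orthonormal eigenvectors as columns) and $\boldsymbol\Lambda=\mathrm{diag}(\lambda_1,\dots,\lambda_d)$, $\lambda_1\ge\cdots\ge\lambda_d>0$. For a real random variable $W$, $Q_W(p)=\inf\{x:\mathbb P(W\le x)\ge p\}$ and $\mathsf T^\alpha_W:=[Q_W(\alpha/2),Q_W(1-\alpha/2)]$. *)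

(* Defs.v *)
From HB Require Import structures.
From mathcomp Require Import all_boot all_order all_algebra.
From mathcomp Require Import all_classical all_reals all_analysis.

Set Implicit Arguments.
Unset Strict Implicit.
Unset Printing Implicit Defensive.
Import Order.TTheory GRing.Theory Num.Theory.
Local Open Scope classical_set_scope.
Local Open Scope ring_scope.

Section Defs.
Context {R : realType} {dT : measure_display} {T : measurableType dT}.
Variable (Pr : probability T R).

Definition orthogonal_mx (n : nat) (A : 'M[R]_n) : Prop := A *m A^T = 1%:M.

Definition expect (f : T -> R) : R := Rintegral Pr setT f.

Definition rv_coord (n : nat) (X : T -> 'cV[R]_n) (i : 'I_n) : T -> R :=
  fun w => X w i 0.

Definition is_random_vector (n : nat) (X : T -> 'cV[R]_n) : Prop :=
  forall i, measurable_fun setT (rv_coord X i).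

Definition finite_second_moments (n : nat) (X : T -> 'cV[R]_n) : Prop :=
  forall i, Pr.-integrable setT (fun w => ((rv_coord X i w) ^+ 2)%:E).

Definition cov_mx (n : nat) (X : T -> 'cV[R]_n) : 'M[R]_n :=
  \matrix_(i, j) (expect (fun w => rv_coord X i w * rv_coord X j w)
                  - expect (rv_coord X i) * expect (rv_coord X j)).

(** Elliptical family with parameters (mu, Sigma, phi), phi : R -> C written
    as (phi_re, phi_im):
      E[exp(i t'X)] = exp(i t'mu) phi(t' Sigma t),
    i.e. real and imaginary parts:
      E[cos(t'X)] = cos(t'mu) phi_re(s) - sin(t'mu) phi_im(s)
      E[sin(t'X)] = sin(t'mu) phi_re(s) + cos(t'mu) phi_im(s). *)
Definition elliptical (n : nat) (X : T -> 'cV[R]_n) (mu : 'cV[R]_n)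
    (Sigma : 'M[R]_n) (phi_re phi_im : R -> R) : Prop :=
  forall t : 'cV[R]_n,
    let tm := (t^T *m mu) 0 0 in
    let s := (t^T *m Sigma *m t) 0 0 in
    expect (fun w => cos ((t^T *m X w) 0 0))
      = cos tm * phi_re s - sin tm * phi_im s /\
    expect (fun w => sin ((t^T *m X w) 0 0))
      = sin tm * phi_re s + cos tm * phi_im s.

Definition quantile (W : T -> R) (p : R) : R :=
  inf [set x : R | (p%:E <= Pr [set w | (W w <= x)%R])%E].

Definition central_event (W : T -> R) (alpha : R) : set T :=
  [set w | quantile W (alpha / 2) <= W w <= quantile W (1 - alpha / 2)].

Definition cond_expect (A : set T) (f : T -> R) : R :=
  Rintegral Pr A f / fine (Pr A).

Definition cond_cov_mx (n : nat) (X : T -> 'cV[R]_n) (A : set T) : 'M[R]_n :=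
  \matrix_(i, j) (cond_expect A (fun w => rv_coord X i w * rv_coord X j w)
                  - cond_expect A (rv_coord X i) * cond_expect A (rv_coord X j)).

End Defs.

(* Main.v *)
(** Write [Z = X - mu], [L u = u' Z] and [<u, v> = u' Sigma v].  The
characteristic function of the pair [(L u, L v)] depends only on the Gram matrix
of [(u, v)], hence so does its law.  Planar uniqueness is obtained without
inversion formulas: trigonometric polynomials form an algebra, and iterating
[s(x) = (3 x - x^3) / 2] on [sin ((x - a) / N)] converges boundedly to the sign of
[x - a] as first the number of iterations and then [N] tends to infinity.

If [u] is [Sigma]-normalised and proportional to the [i]-th row of [P], the
conditioning event is [q1 <= L u <= q2], with [q1 <= 0 <= q2] independent of [P].
Splitting each row of [P] into its component along [u] and a [Sigma]-orthogonal
remainder gives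
[[
  Tr Cov = m Tr Sigma - (m - k) (a' Sigma^2 a) / (a' Sigma a),   a = row i of P,
]]
where [k] and [m] are the conditional variance along [u] and the conditional
second moment along a normalised direction orthogonal to [u].  Reflection and
exchange symmetry of the law of [(L u, L b)] yield [k <= m], and the quotient ranges
between the extreme eigenvalues, which are attained at the eigenvectors. *)

Require Import Defs.
From HB Require Import structures.
From mathcomp Require Import all_boot all_order all_algebra.
From mathcomp Require Import all_classical all_reals all_analysis.
From mathcomp Require Import measurable_realfun ring lra.
Import Order.TTheory GRing.Theory Num.Theory.
Import numFieldNormedType.Exports.
Local Open Scope classical_set_scope.
Local Open Scope ring_scope.
Set Implicit Arguments.
Unset Strict Implicit.
Unset Printing Implicit Defensive.

(** * Trigonometric approximation of half-lines *)

Section Smoothstep.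
Context {R : realType}.
Implicit Types u v : R.

(** The odd cubic fixing -1, 0 and 1, with vanishing derivative at -1 and 1. Iteration drives a
    point of [-1, 1] to its sign, and every iterate is still a polynomial. *)
Definition smoothstep u : R := (3 * u - u ^+ 3) / 2.

Lemma smoothstepN u : smoothstep (- u) = - smoothstep u.
Proof. by rewrite /smoothstep; ring. Qed.

Lemma iter_smoothstepN k u : iter k smoothstep (- u) = - iter k smoothstep u.
Proof. by elim: k => //= k ->; rewrite smoothstepN. Qed.

Lemma iter_smoothstep0 k : iter k smoothstep 0 = 0.
Proof. by elim: k => //= k ->; rewrite /smoothstep; ring. Qed.

Lemma smoothstep_ge u : 0 <= u <= 1 -> u <= smoothstep u <= 1.
Proof.
move=> /andP[u0 u1]; rewrite /smoothstep; apply/andP; split.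
  (* Here [smoothstep u - u = u (1 - u) (1 + u) / 2], and below [1 - smoothstep u = (1 - u) ^+ 2 (2
     + u) / 2]. *)
  have : 0 <= u * (1 - u) * (1 + u) by rewrite !mulr_ge0 ?subr_ge0// addr_ge0.
  by lra.
have : 0 <= (1 - u) ^+ 2 * (2 + u) by rewrite mulr_ge0 ?sqr_ge0// addr_ge0.
by lra.
Qed.

Lemma iter_smoothstep_bounds u k : 0 <= u <= 1 ->
  u <= iter k smoothstep u <= 1.
Proof.
move=> u01; have /andP[u0 _] := u01.
elim: k => [|k /andP[ih1 ih2]] /=; first by move: u01 => /andP[_ ->]; rewrite lexx.
have /andP[h1 ->] : iter k smoothstep u <= smoothstep (iter k smoothstep u) <= 1.
  by apply: smoothstep_ge; rewrite (le_trans u0).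
by rewrite (le_trans ih1).
Qed.

(** Each step multiplies [1 - v] by [(2 - v - v ^+ 2) / 2], which is at most [1 - v / 2], hence at
    most [1 - u / 2] since the iterates stay above [u]. *)
Lemma iter_smoothstep_geometric u k : 0 <= u <= 1 ->
  1 - iter k smoothstep u <= (1 - u / 2) ^+ k.
Proof.
move=> u01; have /andP[u0 u1] := u01.
elim: k => [|k ih]; first by rewrite expr0 /=; lra.
have /andP[h1 h2] := iter_smoothstep_bounds k u01.
rewrite exprSr iterS; move: ih h1 h2; set v := iter _ _ _ => ih h1 h2.
have -> : 1 - smoothstep v = (1 - v) * ((2 - v - v ^+ 2) / 2).
  by rewrite /smoothstep; field.
apply: ler_pM; [by lra | by nra | by [] | by nra].
Qed.

Lemma norm_iter_smoothstep k u : `|u| <= 1 -> `|iter k smoothstep u| <= 1.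
Proof.
have pos v : 0 <= v -> v <= 1 -> `|iter k smoothstep v| <= 1.
  move=> v0 v1; have /andP[h1 h2] := iter_smoothstep_bounds k (u := v) ltac:(by rewrite v0).
  by rewrite ger0_norm// (le_trans v0).
rewrite ler_norml => /andP[uN1 u1]; have [u0|u0] := leP 0 u; first exact: pos.
by rewrite -(opprK u) iter_smoothstepN normrN; apply: pos; lra.
Qed.

Lemma cvg_iter_smoothstep u : `|u| <= 1 ->
  iter k smoothstep u @[k --> \oo] --> Num.sg u.
Proof.
have pos v : 0 < v -> v <= 1 -> iter k smoothstep v @[k --> \oo] --> (1 : R).
  move=> v0 v1; have v01 : 0 <= v <= 1 by rewrite ltW.
  have geo : ((1 : R) - (1 - v / 2) ^+ k) @[k --> \oo] --> (1 : R).
    rewrite -[X in _ --> X](subr0 1); apply: cvgB; first exact: cvg_cst.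
    by apply: cvg_expr; rewrite ger0_norm; lra.
  apply: squeeze_cvgr geo (cvg_cst _); near=> k.
  have := iter_smoothstep_geometric k v01.
  by have /andP[_ ->] := iter_smoothstep_bounds k v01; rewrite andbT; lra.
rewrite ler_norml => /andP[uN1 u1]; case: (sgrP u) => u0.
- by rewrite u0; under eq_fun do rewrite iter_smoothstep0; exact: cvg_cst.
- exact: pos.
- rewrite -(opprK u); under eq_fun do rewrite iter_smoothstepN.
  by apply: cvgN; apply: pos; lra.
Unshelve. all: by end_near.
Qed.

(* [(s ^+ 2 + s) / 2] is the indicator of [0 < s] for a sign [s]. *)
Definition pos_approx k u : R :=
  (iter k smoothstep u ^+ 2 + iter k smoothstep u) / 2.

Lemma norm_pos_approx k u : `|u| <= 1 -> `|pos_approx k u| <= 1.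
Proof.
move=> /(norm_iter_smoothstep k); rewrite /pos_approx !ler_norml.
by move: (iter _ _ _) => v /andP[v1 v2]; apply/andP; split; nra.
Qed.

Lemma cvg_pos_approx u : `|u| <= 1 ->
  pos_approx k u @[k --> \oo] --> ((0 < u)%R%:R : R).
Proof.
move=> u1; have cu := cvg_iter_smoothstep u1.
suff -> : (0 < u)%R%:R = (Num.sg u ^+ 2 + Num.sg u) / 2 :> R.
  rewrite /pos_approx; apply: cvgM; last exact: cvg_cst.
  by apply: cvgD => //; rewrite expr2; under eq_fun do rewrite expr2; exact: cvgM.
by case: sgrP => [u0|u0|u0]; rewrite ?u0 ?ltxx ?(lt_gtF u0) ?mulr1n ?mulr0n; lra.
Qed.

End Smoothstep.

(** * Trigonometric polynomials in two variables *)

Section TrigPoly.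
Context {R : realType}.

(** The free phase [c] makes cosines alone sufficient: phase [- pi / 2] gives sines, and zero
    frequencies give constants. *)
Inductive trig_poly : (R -> R -> R) -> Prop :=
| trig_cos a s t c : trig_poly (fun x y => a * cos (s * x + t * y + c))
| trig_add f g : trig_poly f -> trig_poly g ->
    trig_poly (fun x y => f x y + g x y).

Lemma trig_poly_ext f g : (forall x y, f x y = g x y) ->
  trig_poly f -> trig_poly g.
Proof. by move=> fg; suff -> : f = g by []; apply/funext => x; apply/funext. Qed.

(* [cos a cos b = (cos (a + b) + cos (a - b)) / 2] keeps products inside the span. *)
Lemma trig_poly_mul f g : trig_poly f -> trig_poly g ->
  trig_poly (fun x y => f x y * g x y).
Proof.
move=> tf; elim: tf g => [a s t c g|f1 f2 _ ih1 _ ih2 g tg]; last first.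
  apply: trig_poly_ext (trig_add (ih1 _ tg) (ih2 _ tg)) => x y.
  by rewrite mulrDl.
elim=> [a' s' t' c'|g1 g2 _ ih1 _ ih2]; last first.
  by apply: trig_poly_ext (trig_add ih1 ih2) => x y; rewrite mulrDr.
apply: trig_poly_ext (trig_add
  (trig_cos (a * a' / 2) (s + s') (t + t') (c + c'))
  (trig_cos (a * a' / 2) (s - s') (t - t') (c - c'))) => x y.
have -> : (s + s') * x + (t + t') * y + (c + c') =
  (s * x + t * y + c) + (s' * x + t' * y + c') by ring.
have -> : (s - s') * x + (t - t') * y + (c - c') =
  (s * x + t * y + c) - (s' * x + t' * y + c') by ring.
by rewrite cosD cosB; field.
Qed.

Lemma trig_poly_cst a : trig_poly (fun _ _ => a).
Proof.
by apply: trig_poly_ext (trig_cos a 0 0 0) => x y; rewrite !mul0r !addr0 cos0 mulr1.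
Qed.

Lemma trig_poly_scale a f : trig_poly f -> trig_poly (fun x y => a * f x y).
Proof. by move=> tf; exact: trig_poly_mul (trig_poly_cst a) tf. Qed.

Lemma trig_poly_sinx s a : trig_poly (fun x _ => sin (s * (x - a))).
Proof.
apply: trig_poly_ext (trig_cos 1 s 0 (- (s * a) - pi / 2)) => x y.
by rewrite mul1r -cosBpihalf; congr cos; ring.
Qed.

Lemma trig_poly_siny t b : trig_poly (fun _ y => sin (t * (y - b))).
Proof.
apply: trig_poly_ext (trig_cos 1 0 t (- (t * b) - pi / 2)) => x y.
by rewrite mul1r -cosBpihalf; congr cos; ring.
Qed.

Lemma trig_poly_smoothstep k f : trig_poly f ->
  trig_poly (fun x y => iter k smoothstep (f x y)).
Proof.
move=> tf; elim: k => //= k ih.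
have ih3 := trig_poly_mul ih (trig_poly_mul ih ih).
apply: trig_poly_ext (trig_add (trig_poly_scale (3 / 2) ih)
  (trig_poly_scale (- 2^-1) ih3)) => x y.
by rewrite /smoothstep; field.
Qed.

Lemma trig_poly_pos_approx k f : trig_poly f ->
  trig_poly (fun x y => pos_approx k (f x y)).
Proof.
move=> /(trig_poly_smoothstep k) tf.
apply: trig_poly_ext (trig_add (trig_poly_scale 2^-1 (trig_poly_mul tf tf))
  (trig_poly_scale 2^-1 tf)) => x y.
by rewrite /pos_approx; field.
Qed.

End TrigPoly.

(** * Uniqueness of planar characteristic functions *)

Section BoundedExpectation.
Context {R : realType} {dT : measure_display} {T : measurableType dT}.
Variable Pr : probability T R.

Lemma measurable_preimage (F : T -> R) S : measurable_fun setT F ->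
  measurable S -> measurable (F @^-1` S).
Proof. by move=> mF mS; rewrite -[X in measurable X]setTI; exact: mF. Qed.

Lemma bounded_rv_integrable (f : T -> R) M : measurable_fun setT f ->
  (forall w, `|f w| <= M) -> Pr.-integrable setT (EFin \o f).
Proof.
move=> mf fM; apply: measurable_bounded_integrable => //.
  by rewrite -ge0_fin_numE// fin_num_measure.
by exists M; split=> [|x xM w _]; [exact: num_real | apply: le_trans (fM w) (ltW xM)].
Qed.

Lemma cvg_expect (f_ : nat -> T -> R) (f : T -> R) M :
  (forall k, measurable_fun setT (f_ k)) -> (forall k w, `|f_ k w| <= M) ->
  (forall w, f_ k w @[k --> \oo] --> f w) ->
  expect Pr (f_ k) @[k --> \oo] --> expect Pr f.
Proof.
move=> mf_ fM cf.
have mf : measurable_fun setT f.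
  by apply: (@measurable_fun_cvg _ _ _ _ f_) => // w _; exact: cf.
have [] := @dominated_convergence _ T R Pr setT measurableT
  (fun k => EFin \o f_ k) (EFin \o f) (cst M%:E).
- by move=> k; exact/measurable_EFinP.
- exact/measurable_EFinP.
- by apply: aeW => w _; apply: cvg_EFin; [exact: nearW | exact: cf].
- exact: finite_measure_integrable_cst.
- by apply: aeW => w k _ /=; rewrite lee_fin.
move=> /(integrable_fin_num measurableT) ifin _ cvgI.
by apply: fine_cvg; rewrite fineK.
Qed.

(** Carries equality of expectations through bounded pointwise limits, both in the number of
    iterations and in the vanishing frequency. *)
Lemma eq_expect_cvg (f_ g_ : nat -> T -> R) (f g : T -> R) M :
  (forall k, measurable_fun setT (f_ k)) ->
  (forall k, measurable_fun setT (g_ k)) ->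
  (forall k w, `|f_ k w| <= M) -> (forall k w, `|g_ k w| <= M) ->
  (forall w, f_ k w @[k --> \oo] --> f w) ->
  (forall w, g_ k w @[k --> \oo] --> g w) ->
  (forall k, expect Pr (f_ k) = expect Pr (g_ k)) -> expect Pr f = expect Pr g.
Proof.
move=> mf mg fM gM cf cg fg.
have cF := cvg_expect mf fM cf; have := cvg_expect mg gM cg.
by under eq_fun do rewrite -fg; move=> cG; exact: cvg_unique cF cG.
Qed.

End BoundedExpectation.

(** * Measures determined by open upper rays *)

Section RayUniqueness.
Context {R : realType}.

(** Open upper rays are closed under intersection and generate the Borel sets; the rays from [- k]
    exhaust the line with finite measure. *)
Lemma measure_eq_rays (m1 m2 : {measure set R -> \bar R}) :
  (forall a : R, (m1 `]a, +oo[%classic < +oo)%E) ->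
  (forall a : R, m1 `]a, +oo[%classic = m2 `]a, +oo[%classic) ->
  forall A, measurable A -> m1 A = m2 A.
Proof.
move=> fin eq12 A mA.
apply: (measure_unique (@RGenOInfty.G R) (fun k => `]- k%:R, +oo[%classic)) => //.
- exact: RGenOInfty.measurableE.
- move=> _ _ [a ->] [b ->]; exists (Num.max a b); apply/seteqP; split=> x /=;
    by rewrite !in_itv/= !andbT gt_max => /andP.
- by move=> k; exists (- k%:R).
- rewrite -subTset => x _; exists (Num.bound x) => //=.
  by rewrite in_itv/= andbT ltrNl unstable.ltrNbound.
- by move=> _ [a ->].
Qed.

End RayUniqueness.

(** * From characteristic functions to quadrant probabilities *)

Section PairUniqueness.
Context {R : realType} {dT : measure_display} {T : measurableType dT}.
Variable Pr : probability T R.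

Lemma trig_poly_measurable (f : R -> R -> R) (A B : T -> R) : trig_poly f ->
  measurable_fun setT A -> measurable_fun setT B ->
  measurable_fun setT (fun w => f (A w) (B w)).
Proof.
move=> tf mA mB; elim: tf => [a s t c|f1 f2 _ h1 _ h2]; last exact: measurable_funD.
apply: measurable_funM => //; apply: measurableT_comp.
  by apply: continuous_measurable_fun; exact: continuous_cos.
by do 2 (apply: measurable_funD => //); apply: measurable_funM.
Qed.

Lemma trig_poly_bounded (f : R -> R -> R) : trig_poly f ->
  exists M, forall x y, `|f x y| <= M.
Proof.
elim=> [a s t c|f1 f2 _ [M1 h1] _ [M2 h2]].
  by exists `|a| => x y; rewrite normrM ler_piMr// cos_max.
by exists (M1 + M2) => x y; rewrite (le_trans (ler_normD _ _))// lerD.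
Qed.

Variables A B A' B' : T -> R.
Hypotheses (mA : measurable_fun setT A) (mB : measurable_fun setT B).
Hypotheses (mA' : measurable_fun setT A') (mB' : measurable_fun setT B').
Hypothesis eq_cf : forall s t c,
  expect Pr (fun w => cos (s * A w + t * B w + c)) =
  expect Pr (fun w => cos (s * A' w + t * B' w + c)).

Lemma eq_expect_trig_poly (f : R -> R -> R) : trig_poly f ->
  expect Pr (fun w => f (A w) (B w)) = expect Pr (fun w => f (A' w) (B' w)).
Proof.
have int g C D : trig_poly g -> measurable_fun setT C -> measurable_fun setT D ->
    Pr.-integrable setT (EFin \o (fun w => g (C w) (D w))).
  move=> tg mC mD; have [M gM] := trig_poly_bounded tg.
  by apply: (@bounded_rv_integrable _ _ _ _ _ M) => //; exact: trig_poly_measurable.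
elim=> [a s t c|f1 f2 tf1 h1 tf2 h2]; last first.
  by rewrite /expect !RintegralD//; [congr (_ + _) | exact: int ..].
have tg : trig_poly (fun x y : R => cos (s * x + t * y + c)).
  by apply: trig_poly_ext (trig_cos 1 s t c) => x y; rewrite mul1r.
rewrite /expect (@RintegralZl _ _ _ _ _ (fun w => cos (s * A w + t * B w + c)))//.
  rewrite (@RintegralZl _ _ _ _ _ (fun w => cos (s * A' w + t * B' w + c)))//.
    by congr (_ * _); exact: eq_cf.
  exact: (int _ _ _ tg).
exact: (int _ _ _ tg).
Qed.

(** For [k] larger than the modulus of [x] the argument lies in (-pi, pi), where the sine has the
    sign of its argument, so the sequence is eventually constant. *)
Lemma cvg_pos_sin (x : R) :
  ((0 < sin (k.+1%:R^-1 * x))%R%:R : R) @[k --> \oo] --> ((0 < x)%R%:R : R).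
Proof.
apply: cvg_near_cst; near=> k.
have kx : `|k.+1%:R^-1 * x| < pi.
  rewrite normrM ger0_norm// ltr_pdivrMl//.
  suff xk : `|x| < k%:R.
    rewrite (lt_le_trans xk)// (@le_trans _ _ k.+1%:R) ?ler_nat//.
    by rewrite ler_peMr// (le_trans _ (pi_ge2 R))// ler1n.
  by near: k; exact: nbhs_infty_gtr.
have : 0 < k.+1%:R^-1 :> R by rewrite invr_gt0.
move: kx; set c := k.+1%:R^-1 => kx c0.
congr ((nat_of_bool _)%:R); have [x0|x0|<-] := ltrgtP 0 x.
- apply: sin_gt0_pi; rewrite mulr_gt0//=.
  by rewrite (le_lt_trans (ler_norm _) kx).
- apply/negbTE; rewrite -leNgt -oppr_ge0 -sinN; apply/ltW/sin_gt0_pi.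
  by rewrite -mulrN mulr_gt0 ?oppr_gt0//= mulrN (le_lt_trans _ kx)// -normrN ler_norm.
- by rewrite mulr0 sin0 ltxx.
Unshelve. all: by end_near.
Qed.

Lemma measurable_pos_sub (C : T -> R) a : measurable_fun setT C ->
  measurable_fun setT (fun w => (0 < C w - a)%R%:R : R).
Proof.
move=> mC; rewrite [X in measurable_fun _ X](_ : _ = \1_(C @^-1` `]a, +oo[)).
  by apply: measurable_indic; exact: measurable_preimage.
apply/funext => w; rewrite indicE subr_gt0; congr ((nat_of_bool _)%:R).
by apply/idP/idP; rewrite inE/= in_itv/= andbT.
Qed.

(** Two limits are nested. At a fixed frequency, [pos_approx] of a sine is a trigonometric
    polynomial tending to the indicator that the sine is positive; letting the frequency tend to 0
    then gives the indicator of the ray. *)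
Lemma eq_expect_pos_sub a b :
  expect Pr (fun w => (0 < A w - a)%R%:R * (0 < B w - b)%R%:R) =
  expect Pr (fun w => (0 < A' w - a)%R%:R * (0 < B' w - b)%R%:R).
Proof.
have n01 (p q : bool) : `|p%:R * q%:R : R| <= 1.
  by case: p; case: q; rewrite ?mulr0 ?mulr1 ?normr0 ?normr1.
pose S (c x : R) := sin (c * x).
have mS c (C : T -> R) x : measurable_fun setT C ->
    measurable_fun setT (fun w => (0 < S c (C w - x))%R%:R : R).
  move=> mC; rewrite (_ : (fun w => _) = (fun w => (0 < (S c (C w - x)) - 0)%R%:R)).
    apply: measurable_pos_sub.
    apply: (measurableT_comp (f := @sin R) (g := fun w => c * (C w - x))).
      by apply: continuous_measurable_fun; exact: continuous_sin.
    by apply: measurable_funM => //; exact: measurable_funB.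
  by apply/funext => w; rewrite subr0.
apply: (@eq_expect_cvg _ _ _ _
  (fun k w => (0 < S k.+1%:R^-1 (A w - a))%R%:R * (0 < S k.+1%:R^-1 (B w - b))%R%:R)
  (fun k w => (0 < S k.+1%:R^-1 (A' w - a))%R%:R * (0 < S k.+1%:R^-1 (B' w - b))%R%:R)
  _ _ 1) => //.
- by move=> k; apply: measurable_funM; exact: mS.
- by move=> k; apply: measurable_funM; exact: mS.
- by move=> w; apply: cvgM; exact: cvg_pos_sin.
- by move=> w; apply: cvgM; exact: cvg_pos_sin.
move=> N; set c : R := N.+1%:R^-1.
pose f k (x y : R) := pos_approx k (S c (x - a)) * pos_approx k (S c (y - b)).
have tf k : trig_poly (f k).
  by apply: trig_poly_mul; apply: trig_poly_pos_approx;
    [exact: trig_poly_sinx | exact: trig_poly_siny].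
have f1 k x y : `|f k x y| <= 1.
  by rewrite normrM mulr_ile1 ?normr_ge0// norm_pos_approx// sin_max.
apply: (@eq_expect_cvg _ _ _ _ (fun k w => f k (A w) (B w))
  (fun k w => f k (A' w) (B' w)) _ _ 1) => //.
- by move=> k; exact: trig_poly_measurable.
- by move=> k; exact: trig_poly_measurable.
- by move=> w; apply: cvgM; apply: cvg_pos_approx; exact: sin_max.
- by move=> w; apply: cvgM; apply: cvg_pos_approx; exact: sin_max.
- by move=> k; exact: eq_expect_trig_poly.
Qed.

Lemma expect_pos_sub (C D : T -> R) a b : measurable_fun setT C -> measurable_fun setT D ->
  (expect Pr (fun w => (0 < C w - a)%R%:R * (0 < D w - b)%R%:R))%:E =
  Pr (C @^-1` `]a, +oo[ `&` D @^-1` `]b, +oo[).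
Proof.
move=> mC mD; set E := _ `&` _.
have mE : measurable E.
  by apply: measurableI; exact: measurable_preimage.
rewrite /expect /Rintegral.
rewrite (_ : (fun w => _) = (fun w => (\1_E w)%:E)).
  by rewrite integral_indic// setIT fineK// fin_num_measure.
apply/funext => w; rewrite -natrM mulnb indicE !subr_gt0; congr ((nat_of_bool _)%:R%:E).
by apply/idP/idP; rewrite inE /E /= !in_itv/= !andbT => /andP.
Qed.

Lemma eq_probability_rays a b :
  Pr (A @^-1` `]a, +oo[ `&` B @^-1` `]b, +oo[) =
  Pr (A' @^-1` `]a, +oo[ `&` B' @^-1` `]b, +oo[).
Proof. by rewrite -!expect_pos_sub// eq_expect_pos_sub. Qed.

End PairUniqueness.

(** * From quadrants to the joint law *)

Section PairLaw.
Context {R : realType} {dT : measure_display} {T : measurableType dT}.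
Variable Pr : probability T R.

(** Ray uniqueness for the pushforwards of [Pr] restricted to [D] and [D']. These events carry the
    constraint on the other coordinate, so rays can be replaced by Borel sets one coordinate at a
    time. *)
Lemma eq_probability_preimage (A A' : T -> R) (D D' : set T) :
  measurable_fun setT A -> measurable_fun setT A' ->
  measurable D -> measurable D' ->
  (forall a, Pr (A @^-1` `]a, +oo[ `&` D) = Pr (A' @^-1` `]a, +oo[ `&` D')) ->
  forall S, measurable S -> Pr (A @^-1` S `&` D) = Pr (A' @^-1` S `&` D').
Proof.
move=> mA mA' mD mD' rays S mS.
pose m1 : {measure set R -> \bar R} :=
  measure_function_pushforward__canonical__measure_function_Measure (mrestr Pr mD) mA.
pose m2 : {measure set R -> \bar R} :=
  measure_function_pushforward__canonical__measure_function_Measure (mrestr Pr mD') mA'.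
apply: (@measure_eq_rays _ m1 m2) => // a.
rewrite -ge0_fin_numE//; apply: (fin_num_measure Pr).
by apply: measurableI => //; exact: measurable_preimage.
Qed.

Variables A B A' B' : T -> R.
Hypotheses (mA : measurable_fun setT A) (mB : measurable_fun setT B).
Hypotheses (mA' : measurable_fun setT A') (mB' : measurable_fun setT B').
Hypothesis eq_cf : forall s t c,
  expect Pr (fun w => cos (s * A w + t * B w + c)) =
  expect Pr (fun w => cos (s * A' w + t * B' w + c)).

Lemma eq_probability_rectangles S S' : measurable S -> measurable S' ->
  Pr (A @^-1` S `&` B @^-1` S') = Pr (A' @^-1` S `&` B' @^-1` S').
Proof.
move=> mS mS'.
have mpre := measurable_preimage.
apply: eq_probability_preimage => // [||a]; [exact: mpre | exact: mpre |].
rewrite [in LHS]setIC [in RHS]setIC.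
apply: eq_probability_preimage => // [||b]; [exact: mpre | exact: mpre |].
rewrite [in LHS]setIC [in RHS]setIC; exact: eq_probability_rays.
Qed.

(** Rectangles form a pi-system generating the product sigma-algebra. *)
Lemma eq_probability_pair (S : set (R * R)) : measurable S ->
  Pr ((fun w => (A w, B w)) @^-1` S) = Pr ((fun w => (A' w, B' w)) @^-1` S).
Proof.
move=> mS.
pose G := [set S1 `*` S2 | S1 in @measurable _ R & S2 in @measurable _ R].
pose m1 : {measure set (R * R) -> \bar R} :=
  measure_function_pushforward__canonical__measure_function_Measure Pr
    (measurable_fun_pair mA mB).
pose m2 : {measure set (R * R) -> \bar R} :=
  measure_function_pushforward__canonical__measure_function_Measure Pr
    (measurable_fun_pair mA' mB').
apply: (@measure_unique _ _ _ G (fun=> setT) _ _ _ _ m1 m2) => //.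
- exact: measurable_prod_measurableType.
- move=> _ _ [S1 mS1] [S2 mS2] <- [S3 mS3] [S4 mS4] <-.
  exists (S1 `&` S3); first exact: measurableI.
  by exists (S2 `&` S4); [exact: measurableI | rewrite setXI].
- by move=> _; exists setT => //; exists setT => //; rewrite setXTT.
- by rewrite bigcup_const.
- by move=> _ [S1 mS1] [S2 mS2] <-; exact: eq_probability_rectangles.
- by move=> _; rewrite -ge0_fin_numE//; exact: (fin_num_measure Pr setT measurableT).
Qed.

(** Change of variables to the pushforward laws, on positive and negative parts separately as
    extended reals, so that unbounded [G] such as squares are covered. *)
Lemma eq_expect_pair (G : R -> R -> R) :
  measurable_fun setT (fun z : R * R => G z.1 z.2) ->
  expect Pr (fun w => G (A w) (B w)) = expect Pr (fun w => G (A' w) (B' w)).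
Proof.
move=> mG; rewrite /expect /Rintegral; congr fine.
have ge0 (g : R * R -> \bar R) : measurable_fun setT g -> (forall z, 0 <= g z)%E ->
    (\int[Pr]_w g (A w, B w) = \int[Pr]_w g (A' w, B' w))%E.
  move=> mg g0.
  have mAB := measurable_fun_pair mA mB; have mAB' := measurable_fun_pair mA' mB'.
  have := ge0_integral_pushforward mAB Pr measurableT mg (fun z _ => g0 z).
  have := ge0_integral_pushforward mAB' Pr measurableT mg (fun z _ => g0 z).
  rewrite !preimage_setT => <- <-.
  by apply: eq_measure_integral => S mS _; exact: eq_probability_pair.
have mg : measurable_fun setT (fun z : R * R => (G z.1 z.2)%:E) by exact/measurable_EFinP.
rewrite integralE [RHS]integralE; congr (_ - _)%E.
- by have := ge0 _ (measurable_funepos mg) (fun z => funepos_ge0 _ z); rewrite unlock.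
- by have := ge0 _ (measurable_funeneg mg) (fun z => funeneg_ge0 _ z); rewrite unlock.
Qed.

End PairLaw.

(** * Quantiles *)

Section Quantile.
Context {R : realType} {dT : measure_display} {T : measurableType dT}.
Variable Pr : probability T R.
Implicit Types (W : T -> R) (p : R).

Lemma measurable_le_cst W x : measurable_fun setT W ->
  measurable [set w | W w <= x].
Proof.
move=> mW; have := measurable_preimage mW (measurable_itv `]-oo, x]).
by congr measurable; apply/seteqP; split=> w /=; rewrite in_itv.
Qed.

(** [inf] is a default value on sets without infimum, which must be excluded first. The limit 1 of
    the distribution function at +oo gives a point of the set, the limit 0 at -oo a lower bound. *)
Lemma quantile_has_inf W p : measurable_fun setT W -> 0 < p < 1 ->
  has_inf [set x : R | (p%:E <= Pr [set w | (W w <= x)%R])%E].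
Proof.
move=> mW /andP[p0 p1].
pose V : {RV Pr >-> R} := HB.pack W (isMeasurableFun.Build _ _ _ _ W mW).
have cdfE x : Pr [set w | W w <= x] = cdf V x.
  by congr (Pr _); apply/seteqP; split=> w /=; rewrite in_itv.
have fin x : cdf V x \is a fin_num by exact: fin_num_measure.
split.
  have /filter_ex[x px] : \forall x \near +oo, p < (fine \o cdf V) x.
    exact: cvgr_gt (fine_cvg (cvg_cdfy1 V)) _ p1.
  by exists x => /=; rewrite cdfE -(fineK (fin x)) lee_fin ltW.
have /filter_ex[x px] : \forall x \near -oo, (fine \o cdf V) x < p.
  exact: cvgr_lt (fine_cvg (cvg_cdfNy0 V)) _ p0.
exists x => y /=; rewrite cdfE => py; rewrite leNgt; apply/negP => yx.
have : (cdf V y <= cdf V x)%E by apply: cdf_nondecreasing; exact: ltW.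
by move=> /(le_trans py); rewrite -(fineK (fin x)) lee_fin leNgt px.
Qed.

Lemma quantile_affine W c m p : measurable_fun setT W -> 0 < p < 1 -> 0 < c ->
  quantile Pr (fun w => c * W w + m) p = c * quantile Pr W p + m.
Proof.
move=> mW p01 c0; rewrite /quantile.
have [S0 Slb] := quantile_has_inf mW p01.
set S := [set x | _] in S0 Slb *; set S' := [set x | _].
have SE x : S' x <-> S ((x - m) / c).
  rewrite /S' /S /=; suff -> : [set w | c * W w + m <= x] = [set w | W w <= (x - m) / c] by [].
  by apply/seteqP; split=> w /=; rewrite ler_pdivlMr// lerBrDr mulrC.
have SE' x : S x -> S' (c * x + m).
  by move=> Sx; apply/SE; rewrite addrK mulrC mulKf// gt_eqF.
have lbS' : lbound S' (c * inf S + m).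
  move=> x /SE /(ge_inf Slb); rewrite ler_pdivlMr// mulrC => h; by rewrite -lerBrDr.
apply/eqP; rewrite eq_le; apply/andP; split; last first.
  apply: lb_le_inf lbS'; have [x Sx] := S0; exists (c * x + m); exact: SE'.
rewrite -lerBlDr -ler_pdivrMl// mulrC; apply: lb_le_inf => // x /SE' S'x.
rewrite ler_pdivrMr// lerBlDr mulrC; apply: ge_inf => //; by exists (c * inf S + m).
Qed.

Section Symmetric.
Variable W : T -> R.
Hypothesis mW : measurable_fun setT W.
Hypothesis symW : forall x,
  Pr [set w | W w <= x] = Pr [set w | - W w <= x].

Let mNW : measurable_fun setT (fun w => - W w).
Proof. exact: measurableT_comp. Qed.

(** The events [W <= 0] and [- W <= 0] cover the space with equal probabilities, hence at least 1/2
    each, so 0 belongs to the defining set. *)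
Lemma quantile_le0 p : 0 < p <= 1 / 2 -> quantile Pr W p <= 0.
Proof.
move=> /andP[p0 p2]; have p01 : 0 < p < 1 by rewrite p0/=; lra.
have [_ lb] := quantile_has_inf mW p01.
apply: ge_inf => //=.
have m1 := measurable_le_cst 0 mW; have m2 := measurable_le_cst 0 mNW.
have : (1 <= Pr [set w | (W w <= 0)%R] + Pr [set w | (- W w <= 0)%R])%E.
  rewrite -(probability_setT Pr); apply: le_trans (measureU2 _ m1 m2).
  apply: le_measure; rewrite ?inE//; first exact: measurableU.
  by move=> w _ /=; have [|/ltW] := leP (W w) 0; [left | right; rewrite oppr_le0].
rewrite -symW -(fineK (fin_num_measure Pr _ m1)) -EFinD !lee_fin.
by lra.
Qed.

(** For [x < 0] the events [W <= x] and [- W <= x] are disjoint and equally likely, so neither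
    exceeds 1/2 and [x] lies outside the defining set. *)
Lemma quantile_ge0 p : 1 / 2 < p < 1 -> 0 <= quantile Pr W p.
Proof.
move=> /andP[p2 p1]; have p01 : 0 < p < 1 by rewrite p1 andbT; lra.
have [S0 _] := quantile_has_inf mW p01.
apply: lb_le_inf => // x /= px; rewrite leNgt; apply/negP => x0.
have m1 := measurable_le_cst x mW; have m2 := measurable_le_cst x mNW.
have : (Pr [set w | (W w <= x)%R] + Pr [set w | (- W w <= x)%R] <= 1)%E.
  rewrite -measureU//; first by apply: probability_le1; exact: measurableU.
  apply/seteqP; split=> // w /= [h1 h2]; lra.
move: px; rewrite -symW -(fineK (fin_num_measure Pr _ m1)) -EFinD !lee_fin.
by lra.
Qed.

End Symmetric.
End Quantile.

(** * Conditional second moments of elliptical vectors *)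

Section SquareIntegrable.
Context {R : realType} {dT : measure_display} {T : measurableType dT}.
Variable Pr : probability T R.
Implicit Types f g : T -> R.

Definition square_integrable f := measurable_fun setT f /\
  Pr.-integrable setT (fun w => (f w ^+ 2)%:E).

Lemma square_integrable_mul f g : square_integrable f -> square_integrable g ->
  Pr.-integrable setT (EFin \o (fun w => f w * g w)).
Proof.
move=> [mf If] [mg Ig]; have := integrableD measurableT If Ig.
apply: le_integrable => //; first by apply/measurable_EFinP/measurable_funM.
move=> w _ /=; rewrite lee_fin [leRHS]ger0_norm ?addr_ge0 ?sqr_ge0//.
by rewrite ler_norml; apply/andP; split; nra.
Qed.

Lemma square_integrableD f g : square_integrable f -> square_integrable g ->
  square_integrable (fun w => f w + g w).
Proof.
move=> sf sg; split; first by case: sf sg => mf _ [mg _]; exact: measurable_funD.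
have Ifg := square_integrable_mul sf sg; case: sf sg => [mf If] [mg Ig].
have := integrableD measurableT (integrableD measurableT If Ig)
  (integrableZl measurableT 2 Ifg).
apply: eq_integrable => // w _ /=; rewrite -EFinM -!EFinD; congr EFin; ring.
Qed.

Lemma square_integrableZ a f : square_integrable f ->
  square_integrable (fun w => a * f w).
Proof.
move=> [mf If]; split; first exact: measurable_funM.
apply: eq_integrable (integrableZl measurableT (a ^+ 2) If) => // w _.
by rewrite -EFinM exprMn.
Qed.

Lemma square_integrable_cst a : square_integrable (fun=> a).
Proof. by split=> //; exact: (finite_measure_integrable_cst Pr (a ^+ 2)). Qed.

Lemma square_integrable_sum (I : Type) (s : seq I) (F : I -> T -> R) :
  (forall i, square_integrable (F i)) ->
  square_integrable (fun w => \sum_(i <- s) F i w).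
Proof.
move=> sF; elim: s => [|i s ih].
  by under eq_fun do rewrite big_nil; exact: square_integrable_cst.
by under eq_fun do rewrite big_cons; exact: square_integrableD.
Qed.

Lemma square_integrable_integrable f : square_integrable f ->
  Pr.-integrable setT (EFin \o f).
Proof.
move=> sf; apply: eq_integrable (square_integrable_mul sf (square_integrable_cst 1)) => //.
by move=> w _ /=; rewrite mulr1.
Qed.

Lemma Rintegral_affine_sq A f g a : measurable A ->
  square_integrable f -> square_integrable g ->
  Rintegral Pr A (fun w => (a * f w + g w) ^+ 2) =
  a ^+ 2 * Rintegral Pr A (fun w => f w ^+ 2) +
  2 * a * Rintegral Pr A (fun w => g w * f w) + Rintegral Pr A (fun w => g w ^+ 2).
Proof.
move=> mA sf sg.
have sub h : Pr.-integrable setT (EFin \o h) -> Pr.-integrable A (EFin \o h).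
  by apply: integrableS.
have Iff : Pr.-integrable A (EFin \o (fun w => f w ^+ 2)) by apply: sub; case: sf.
have Igg : Pr.-integrable A (EFin \o (fun w => g w ^+ 2)) by apply: sub; case: sg.
have Igf : Pr.-integrable A (EFin \o (fun w => g w * f w)).
  by apply: sub; exact: square_integrable_mul.
have IZ h c : Pr.-integrable A (EFin \o h) ->
    Pr.-integrable A (EFin \o (fun w => c * h w)).
  by move=> Ih; apply: eq_integrable (integrableZl mA c Ih) => // w _; rewrite /= EFinM.
have I1 := IZ _ (a ^+ 2) Iff; have I2 := IZ _ (2 * a) Igf.
have I12 := integrableD mA I1 I2.
transitivity (Rintegral Pr A
    (fun w => a ^+ 2 * f w ^+ 2 + 2 * a * (g w * f w) + g w ^+ 2)).
  by apply: eq_Rintegral => w _; ring.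
by rewrite RintegralD// RintegralD// !RintegralZl.
Qed.

Lemma Rintegral_affine A f g a : measurable A ->
  square_integrable f -> square_integrable g ->
  Rintegral Pr A (fun w => a * f w + g w) =
  a * Rintegral Pr A f + Rintegral Pr A g.
Proof.
move=> mA sf sg.
have int h : square_integrable h -> Pr.-integrable A (EFin \o h).
  by move=> /square_integrable_integrable; apply: integrableS.
rewrite RintegralD//; last exact: int.
  by rewrite RintegralZl//; exact: int.
by apply: int; exact: square_integrableZ.
Qed.

Definition cond_var (E : set T) (f : T -> R) : R :=
  cond_expect Pr E (fun w => f w ^+ 2) - cond_expect Pr E f ^+ 2.

Lemma cond_var_shift E f c : measurable E -> square_integrable f ->
  cond_var E (fun w => f w + c) = cond_var E f.
Proof.
move=> mE sf; rewrite /cond_var /cond_expect.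
have sc := square_integrable_cst c.
have -> : Rintegral Pr E (fun w => f w + c) =
    Rintegral Pr E f + c * fine (Pr E).
  rewrite -(Rintegral_cst Pr mE) -[in RHS](mul1r (Rintegral Pr E f)).
  rewrite -(Rintegral_affine 1 mE sf sc).
  by apply: eq_Rintegral => w _; rewrite mul1r.
have -> : Rintegral Pr E (fun w => (f w + c) ^+ 2) =
    Rintegral Pr E (fun w => f w ^+ 2) + 2 * (c * Rintegral Pr E f) +
    c ^+ 2 * fine (Pr E).
  rewrite -(Rintegral_cst Pr mE) -RintegralZl//.
    have := Rintegral_affine_sq 1 mE sf sc; rewrite expr1n !mul1r mulr1 => <-.
    by apply: eq_Rintegral => w _; rewrite mul1r.
  by apply: (@integrableS _ _ _ _ setT) => //; exact: square_integrable_integrable.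
(* On a null event all quotients are 0, the inverse of 0 being 0. *)
have [->|p0] := eqVneq (fine (Pr E)) 0; first by rewrite invr0 !mulr0.
by field.
Qed.

End SquareIntegrable.

(** * Joint laws of centred linear forms *)

Section Elliptical.
Context {R : realType} {dT : measure_display} {T : measurableType dT}.
Variables (Pr : probability T R) (n : nat) (X : T -> 'cV[R]_n).
Variables (mu : 'cV[R]_n) (Sigma : 'M[R]_n) (phi_re phi_im : R -> R).
Hypotheses (mX : is_random_vector X) (sX : finite_second_moments Pr X).
Hypothesis ellX : elliptical Pr X mu Sigma phi_re phi_im.
Hypothesis symSigma : Sigma^T = Sigma.
Implicit Types u v t : 'cV[R]_n.

Definition lin (X : T -> 'cV[R]_n) (mu u : 'cV[R]_n) (w : T) : R :=
  (u^T *m (X w - mu)) 0 0.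

Definition gram (Sigma : 'M[R]_n) u v : R := (u^T *m Sigma *m v) 0 0.

Local Notation L := (lin X mu).
Local Notation "<< u , v >>" := (gram Sigma u v).

Lemma linD u v w : L (u + v) w = L u w + L v w.
Proof. by rewrite /lin [(_ + _)^T]linearD mulmxDl mxE. Qed.

Lemma linZ a u w : L (a *: u) w = a * L u w.
Proof. by rewrite /lin [(_ *: _)^T]linearZ -scalemxAl mxE. Qed.


Lemma lin0 w : L 0 w = 0.
Proof. by rewrite /lin trmx0 mul0mx mxE. Qed.

Lemma gramC u v : << u, v >> = << v, u >>.
Proof.
rewrite /gram; suff -> : u^T *m Sigma *m v = (v^T *m Sigma *m u)^T by rewrite mxE.
by rewrite !trmx_mul trmxK symSigma mulmxA.
Qed.

Lemma gramDl u v t : << u + v, t >> = << u, t >> + << v, t >>.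
Proof. by rewrite /gram [(_ + _)^T]linearD !mulmxDl mxE. Qed.

Lemma gramZl a u v : << a *: u, v >> = a * << u, v >>.
Proof. by rewrite /gram [(_ *: _)^T]linearZ -!scalemxAl mxE. Qed.

Lemma gramDr u v t : << t, u + v >> = << t, u >> + << t, v >>.
Proof. by rewrite /gram mulmxDr mxE. Qed.

Lemma gramZr a u v : << u, a *: v >> = a * << u, v >>.
Proof. by rewrite /gram -scalemxAr mxE. Qed.

Lemma square_integrable_lin u : square_integrable Pr (L u).
Proof.
rewrite (_ : L u = fun w => \sum_j u j 0 * (rv_coord X j w + - mu j 0)).
  apply: square_integrable_sum => j; apply: square_integrableZ.
  apply: square_integrableD; last exact: square_integrable_cst.
  by split; [exact: mX | exact: sX].
by apply/funext => w; rewrite /lin mxE; apply: eq_bigr => j _; rewrite !mxE.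
Qed.

Lemma measurable_lin u : measurable_fun setT (L u).
Proof. by case: (square_integrable_lin u). Qed.

(** Writing [c = (c - tm) + tm] with [tm = t' mu] combines both parts of the characteristic
    function; the location cancels, leaving dependence on [t] only through [<< t, t >>]. *)
Lemma expect_cos_lin t c : expect Pr (fun w => cos (L t w + c)) =
  cos c * phi_re << t, t >> - sin c * phi_im << t, t >>.
Proof.
have [] := ellX t; rewrite -/(gram Sigma t t); set tm := (t^T *m mu) 0 0.
set W := fun w => (t^T *m X w) 0 0 => hc hs.
have WE w : W w = L t w + tm by rewrite /W /lin /tm mulmxBr !mxE subrK.
have mW : measurable_fun setT W.
  rewrite (_ : W = fun w => L t w + tm); last exact/funext.
  by apply: measurable_funD => //; exact: measurable_lin.
have icos : Pr.-integrable setT (EFin \o (fun w => cos (W w))).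
  apply: (@bounded_rv_integrable _ _ _ _ _ 1) => [|w]; last exact: cos_max.
  apply: measurableT_comp => //.
  by apply: continuous_measurable_fun; exact: continuous_cos.
have isin : Pr.-integrable setT (EFin \o (fun w => sin (W w))).
  apply: (@bounded_rv_integrable _ _ _ _ _ 1) => [|w]; last exact: sin_max.
  apply: measurableT_comp => //.
  by apply: continuous_measurable_fun; exact: continuous_sin.
have IZ h a : Pr.-integrable setT (EFin \o h) ->
    Pr.-integrable setT (EFin \o (fun w => a * h w)).
  by move=> Ih; exact: eq_integrable (integrableZl measurableT a Ih).
transitivity (expect Pr (fun w => cos (c - tm) * cos (W w) - sin (c - tm) * sin (W w))).
  by apply: eq_Rintegral => w _; rewrite -cosD WE; congr cos; ring.
rewrite /expect RintegralB//; [|exact: IZ..].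
rewrite !RintegralZl//; move: hc hs; rewrite /expect => -> ->.
have -> : cos c = cos (c - tm) * cos tm - sin (c - tm) * sin tm.
  by rewrite -cosD subrK.
have -> : sin c = sin (c - tm) * cos tm + cos (c - tm) * sin tm.
  by rewrite -sinD subrK.
ring.
Qed.

(** [s L u + t L v] is the form of the single vector [s u + t v], whose [gram] square is a
    combination of the three matched entries. *)
Lemma eq_cf_lin u v u' v' :
  << u, u >> = << u', u' >> -> << u, v >> = << u', v' >> ->
  << v, v >> = << v', v' >> -> forall s t c : R,
  expect Pr (fun w => cos (s * L u w + t * L v w + c)) =
  expect Pr (fun w => cos (s * L u' w + t * L v' w + c)).
Proof.
move=> uu uv vv s t c.
have linE x y w : s * L x w + t * L y w + c = L (s *: x + t *: y) w + c.
  by rewrite linD !linZ.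
under [in LHS]eq_fun do rewrite linE; under [in RHS]eq_fun do rewrite linE.
rewrite !expect_cos_lin; suff -> : << s *: u + t *: v, s *: u + t *: v >> =
  << s *: u' + t *: v', s *: u' + t *: v' >> by [].
rewrite !gramDl !gramDr !gramZl !gramZr uu vv.
by rewrite (gramC v u) (gramC v' u') uv.
Qed.

Lemma eq_expect_lin u v u' v' (G : R -> R -> R) :
  << u, u >> = << u', u' >> -> << u, v >> = << u', v' >> ->
  << v, v >> = << v', v' >> ->
  measurable_fun setT (fun z : R * R => G z.1 z.2) ->
  expect Pr (fun w => G (L u w) (L v w)) = expect Pr (fun w => G (L u' w) (L v' w)).
Proof.
move=> uu uv vv; have mL := measurable_lin.
by apply: eq_expect_pair => //; exact: eq_cf_lin.
Qed.

Lemma eq_probability_lin_le u u' x : << u, u >> = << u', u' >> ->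
  Pr [set w | L u w <= x] = Pr [set w | L u' w <= x].
Proof.
move=> uu; have mL := measurable_lin.
have := eq_probability_rectangles (mL u) (mL u) (mL u') (mL u')
  (eq_cf_lin uu uu uu) (measurable_itv `]-oo, x]) measurableT.
rewrite !preimage_setT !setIT => <-.
by congr (Pr _); apply/seteqP; split=> w /=; rewrite in_itv.
Qed.

Lemma quantile_lin u u' p : << u, u >> = << u', u' >> ->
  quantile Pr (L u) p = quantile Pr (L u') p.
Proof.
move=> uu; congr inf; apply/seteqP; split=> x /=;
  by rewrite (eq_probability_lin_le x uu).
Qed.

(** [u] and [- u] have the same [gram] square, so their forms have the same law. *)
Lemma lin_symmetric u x :
  Pr [set w | L u w <= x] = Pr [set w | - L u w <= x].
Proof.
rewrite (@eq_probability_lin_le u (-1 *: u)).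
  by congr (Pr _); apply/seteqP; split=> w /=; rewrite linZ mulN1r.
by rewrite gramZl gramZr; ring.
Qed.

(** * Moments on the event that a linear form lies in an interval *)

Section Band.
Variables q1 q2 : R.
Hypotheses (q1_le0 : q1 <= 0) (q2_ge0 : 0 <= q2).
Hypothesis psdSigma : forall v, 0 <= << v, v >>.

Definition band (W : T -> R) : set T := [set w | q1 <= W w <= q2].

Let g (x : R) : R := (q1 <= x <= q2)%R%:R.

Let mg : measurable_fun setT g.
Proof.
rewrite (_ : g = \1_(`[q1, q2]%classic)); first exact: measurable_indic.
apply/funext => x; rewrite indicE /g; congr ((nat_of_bool _)%:R).
by apply/idP/idP; rewrite inE/= in_itv.
Qed.

Lemma measurable_band u : measurable (band (L u)).
Proof.
have := measurable_preimage (measurable_lin u) (measurable_itv `[q1, q2]).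
by congr measurable; apply/seteqP; split=> w /=; rewrite in_itv.
Qed.

Lemma Rintegral_band u f :
  Rintegral Pr (band (L u)) f = expect Pr (fun w => f w * g (L u w)).
Proof.
rewrite Rintegral_mkcond; apply: eq_Rintegral => w _.
rewrite patchE /g; have [|] := boolP (w \in band (L u)).
  by rewrite inE /band /= => ->; rewrite mulr1.
by rewrite notin_setE /band /= => /negP/negbTE ->; rewrite mulr0.
Qed.

Lemma eq_Rintegral_band u v u' v' (F : R -> R -> R) :
  << u, u >> = << u', u' >> -> << u, v >> = << u', v' >> ->
  << v, v >> = << v', v' >> ->
  measurable_fun setT (fun z : R * R => F z.1 z.2) ->
  Rintegral Pr (band (L u)) (fun w => F (L u w) (L v w)) =
  Rintegral Pr (band (L u')) (fun w => F (L u' w) (L v' w)).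
Proof.
move=> uu uv vv mF; rewrite !Rintegral_band.
apply: (eq_expect_lin (G := fun x y => F x y * g x) uu uv vv).
by apply: measurable_funM => //; exact: measurableT_comp mg measurable_fst.
Qed.

(** Replacing [b] by [- b] preserves the Gram matrix of an orthogonal pair, so the integral equals
    its negative. *)
Lemma Rintegral_band_orthogonal u b : << u, b >> = 0 ->
  Rintegral Pr (band (L u)) (L b) = 0.
Proof.
move=> ub.
have : Rintegral Pr (band (L u)) (L b) =
       Rintegral Pr (band (L u)) (fun w => -1 * L b w).
  under [RHS]eq_Rintegral do rewrite -linZ.
  apply: (eq_Rintegral_band (F := fun x y => y)) => //.
  - by rewrite gramZr ub mulr0.
  - by rewrite gramZl gramZr; ring.
  - exact: measurable_snd.
rewrite (@RintegralZl _ _ _ Pr _ (L b))//; [by lra | exact: measurable_band |].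
apply: (@integrableS _ _ _ _ setT) => //; first exact: measurable_band.
exact: square_integrable_integrable (square_integrable_lin _).
Qed.

(** The same reflection applies, the integrand being odd in [L b]. *)
Lemma Rintegral_band_cross u b : << u, b >> = 0 ->
  Rintegral Pr (band (L u)) (fun w => L b w * L u w) = 0.
Proof.
move=> ub.
have : Rintegral Pr (band (L u)) (fun w => L b w * L u w) =
       Rintegral Pr (band (L u)) (fun w => -1 * (L b w * L u w)).
  transitivity (Rintegral Pr (band (L u)) (fun w => L (-1 *: b) w * L u w)).
    2: by apply: eq_Rintegral => w _; rewrite linZ mulrA.
  apply: (@eq_Rintegral_band u b u (-1 *: b) (fun x y => y * x)) => //.
  - by rewrite gramZr ub mulr0.
  - by rewrite gramZl gramZr; ring.
  - exact: measurable_funM.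
rewrite (@RintegralZl _ _ _ Pr _ (fun w => L b w * L u w))//;
  [by lra | exact: measurable_band |].
apply: (@integrableS _ _ _ _ setT) => //; first exact: measurable_band.
by apply: square_integrable_mul; exact: square_integrable_lin.
Qed.

(** As [q1 <= 0 <= q2], only one endpoint constrains [x], according to its sign, and the other one
    constrains [- x]. *)
Let band_count x : g x + g (- x) = (`|x| <= - q1)%R%:R + (`|x| <= q2)%R%:R.
Proof.
rewrite /g; have [x0|x0] := leP 0 x.
  have -> : (q1 <= x <= q2) = (x <= q2) by rewrite (le_trans q1_le0).
  have -> : (q1 <= - x <= q2) = (x <= - q1).
    by rewrite lerNr andb_idr// => _; move: q2_ge0; lra.
  by rewrite ger0_norm// addrC.
have -> : (q1 <= x <= q2) = (- x <= - q1).
  by rewrite lerN2 andb_idr// => _; move: q2_ge0; lra.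
have -> : (q1 <= - x <= q2) = (- x <= q2).
  by rewrite andb_idl// => _; move: q1_le0; lra.
by rewrite ltr0_norm.
Qed.

(* [g x + g (- x)] is nonincreasing in [`|x|], even for an asymmetric band. *)
Let band_count_antitone x y :
  (x ^+ 2 - y ^+ 2) * (g x + g (- x) - (g y + g (- y))) <= 0.
Proof.
rewrite !band_count -(real_normK (num_real x)) -(real_normK (num_real y)).
have nat_le (p q : bool) : (p -> q) -> p%:R <= q%:R :> R.
  by case: p; case: q => // /(_ isT).
wlog xy : x y / `|x| <= `|y|.
  move=> H; have [/H//|/ltW/H] := leP `|x| `|y|.
  by move=> h; rewrite -mulrNN !opprB.
rewrite mulr_le0_ge0// ?subr_le0 ?ler_pXn2r ?nnegrE// subr_ge0.
by rewrite lerD// nat_le// => /(le_trans xy).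
Qed.

(* Averaging over [u -> - u] and over the exchange of [u] and [b] makes the
   integrand of the difference pointwise nonpositive. *)
Lemma Rintegral_band_sq_le u b : << u, u >> = 1 -> << b, b >> = 1 ->
  << u, b >> = 0 ->
  Rintegral Pr (band (L u)) (fun w => L u w ^+ 2) <=
  Rintegral Pr (band (L u)) (fun w => L b w ^+ 2).
Proof.
move=> uu bb ub.
have sq2 t := (square_integrable_lin t).2.
have mL := measurable_lin.
have g1 x : `|g x| <= 1 by rewrite /g; case: (_ && _); rewrite ?normr1 ?normr0.
(* Taking [h] as identity or reflection, and exchanging [s] with [t], produces four integrands of
   equal expectation. *)
pose D (s t : 'cV[R]_n) (h : R -> R) w := (L s w ^+ 2 - L t w ^+ 2) * g (h (L s w)).
have iD s t h : measurable_fun setT h -> Pr.-integrable setT (EFin \o D s t h).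
  move=> mh; apply: le_integrable (integrableD measurableT (sq2 s) (sq2 t)) => //.
    apply/measurable_EFinP/measurable_funM.
      by apply: measurable_funB; exact: measurable_funX.
    by apply: measurableT_comp => //; exact: measurableT_comp.
  move=> w _ /=; rewrite lee_fin [leRHS]ger0_norm ?addr_ge0 ?sqr_ge0//.
  rewrite normrM -[leRHS]mulr1 ler_pM// (le_trans (ler_normB _ _))//.
  by rewrite !ger0_norm ?sqr_ge0.
have mN : measurable_fun setT (-%R : R -> R) by [].
have law s t h : measurable_fun setT h -> << s, s >> = 1 -> << t, t >> = 1 ->
    << s, t >> = 0 -> expect Pr (D s t h) = expect Pr (D u b h).
  move=> mh ss tt st.
  apply: (eq_expect_lin (G := fun x y => (x ^+ 2 - y ^+ 2) * g (h x))).
  - by rewrite ss.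
  - by rewrite st.
  - by rewrite tt.
  apply: measurable_funM; first by apply: measurable_funB; exact: measurable_funX.
  apply: measurableT_comp => //; exact: measurableT_comp mh measurable_fst.
have refl : expect Pr (D u b -%R) = expect Pr (D u b id).
  rewrite -(@law (-1 *: u) b id)//.
  - by apply: eq_Rintegral => w _; rewrite /D linZ mulN1r sqrrN.
  - by rewrite gramZl gramZr uu; ring.
  - by rewrite gramZl ub mulr0.
have bu : << b, u >> = 0 by rewrite gramC.
have swap := law b u id (@measurable_id _ _ _) bb uu bu.
have swapN := law b u -%R mN bb uu bu.
set e := expect Pr (D u b id) in refl swap *.
have i1 := iD u b id (@measurable_id _ _ _); have i2 := iD u b _ mN.
have i3 := iD b u id (@measurable_id _ _ _); have i4 := iD b u _ mN.
have i12 := integrableD measurableT i1 i2; have i34 := integrableD measurableT i3 i4.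
(* The four integrands add up pointwise to the product bounded in [band_count_antitone], while each
   has expectation [e]. *)
have e4 : e + e + (e + e) <= 0.
  have -> : e + e + (e + e) = expect Pr (fun w =>
      D u b id w + D u b -%R w + (D b u id w + D b u -%R w)).
    transitivity (expect Pr (D u b id) + expect Pr (D u b -%R) +
      (expect Pr (D b u id) + expect Pr (D b u -%R))).
      by rewrite swapN refl swap.
    by rewrite /expect RintegralD//; congr (_ + _); rewrite RintegralD.
  rewrite -[leRHS](mul0r (fine (Pr setT))) -(Rintegral_cst Pr measurableT 0).
  apply: le_Rintegral => //.
  - by apply: eq_integrable (integrableD measurableT i12 i34).
  - exact: (finite_measure_integrable_cst Pr 0).
  - move=> w _; apply: le_trans (band_count_antitone (L u w) (L b w)).
    by rewrite le_eqVlt; apply/orP; left; apply/eqP; rewrite /D; ring.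
have mB := measurable_band u.
have iB t : Pr.-integrable (band (L u)) (EFin \o (fun w => L t w ^+ 2)).
  by apply: integrableS (sq2 t).
rewrite -subr_le0 -RintegralB// Rintegral_band -/(D u b id) -/e.
by lra.
Qed.

(** All orthonormal pairs give the same second moment [m], by equality of joint laws; scaling by the
    norm of [b] gives the general case. *)
Lemma Rintegral_band_sq (u0 : 'cV[R]_n) : << u0, u0 >> = 1 ->
  exists2 m, Rintegral Pr (band (L u0)) (fun w => L u0 w ^+ 2) <= m &
    forall u b, << u, u >> = 1 -> << u, b >> = 0 ->
    Rintegral Pr (band (L u)) (fun w => L b w ^+ 2) = << b, b >> * m.
Proof.
move=> u00.
have mx2 : measurable_fun setT (fun z : R * R => z.1 ^+ 2) by exact: measurable_funX.
have my2 : measurable_fun setT (fun z : R * R => z.2 ^+ 2) by exact: measurable_funX.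
have [[u1 [b1 [uu1 bb1 ub1]]]|none] := pselect (exists u1 b1,
    [/\ << u1, u1 >> = 1, << b1, b1 >> = 1 & << u1, b1 >> = 0]).
  exists (Rintegral Pr (band (L u1)) (fun w => L b1 w ^+ 2)).
    apply: le_trans (Rintegral_band_sq_le uu1 bb1 ub1).
    rewrite le_eqVlt; apply/orP; left; apply/eqP.
    by apply: (@eq_Rintegral_band u0 u0 u1 u1 (fun x y => x ^+ 2)) => //; rewrite u00.
  move=> u b uu ub; set c := Num.sqrt << b, b >>.
  have c2 : c ^+ 2 = << b, b >> by rewrite sqr_sqrtr.
  transitivity (Rintegral Pr (band (L u1)) (fun w => L (c *: b1) w ^+ 2)).
    apply: (@eq_Rintegral_band u b u1 (c *: b1) (fun x y => y ^+ 2)) => //.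
    - by rewrite uu.
    - by rewrite gramZr ub1 mulr0.
    - by rewrite gramZl gramZr bb1 mulr1 -expr2.
  rewrite -RintegralZl//; last 2 first.
  - exact: measurable_band.
  - apply: (@integrableS _ _ _ _ setT) => //; first exact: measurable_band.
    exact: (square_integrable_lin b1).2.
  by apply: eq_Rintegral => w _; rewrite linZ exprMn c2.
(* Without an orthonormal pair, as in dimension one, every [b] orthogonal to [u] has zero [gram]
   square, so [m] gets multiplied by 0 and may be taken equal to its lower bound. *)
exists (Rintegral Pr (band (L u0)) (fun w => L u0 w ^+ 2)) => // u b uu ub.
have [bb|bb] := eqVneq << b, b >> 0; last first.
  exfalso; apply: none; exists u, ((Num.sqrt << b, b >>)^-1 *: b); split => //.
    rewrite gramZl gramZr mulrA -invfM -expr2 sqr_sqrtr// mulVf//.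
  by rewrite gramZr ub mulr0.
rewrite bb mul0r; transitivity (Rintegral Pr (band (L u)) (fun w => L 0 w ^+ 2)).
  apply: (@eq_Rintegral_band u b u 0 (fun x y => y ^+ 2)) => //.
  - by rewrite ub -(scale0r u) gramZr mul0r.
  - by rewrite bb -(scale0r u) gramZr mul0r.
under eq_Rintegral do rewrite lin0 expr0n /=.
by rewrite (Rintegral_cst Pr (measurable_band u)) mul0r.
Qed.

(** In [v = c u + b] with [c = << u, v >>], the part [b] is orthogonal to [u]: its mean and its
    cross moment with [L u] on the band vanish, so the two contributions add. *)
Lemma cond_var_band (u0 : 'cV[R]_n) : << u0, u0 >> = 1 ->
  exists k m, k <= m /\ forall u v, << u, u >> = 1 ->
    cond_var Pr (band (L u)) (L v) =
    << u, v >> ^+ 2 * k + (<< v, v >> - << u, v >> ^+ 2) * m.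
Proof.
move=> u00; have [M leM HM] := Rintegral_band_sq u00.
pose I f := Rintegral Pr (band (L u0)) f; pose p := fine (Pr (band (L u0))).
exists (I (fun w => L u0 w ^+ 2) / p - (I (L u0) / p) ^+ 2), (M / p); split.
  (* The squared conditional mean subtracted in [k] only lowers it, and the second moment along [u0]
     is at most [M]. *)
  rewrite lerBlDr (le_trans (_ : _ <= M / p))// ?lerDl ?sqr_ge0//.
  by rewrite ler_wpM2r// invr_ge0 fine_ge0.
move=> u v uu; rewrite /cond_var /cond_expect.
have law F : measurable_fun setT F ->
    Rintegral Pr (band (L u)) (fun w => F (L u w)) = I (fun w => F (L u0 w)).
  move=> mF; apply: (@eq_Rintegral_band u u u0 u0 (fun x y => F x)); rewrite ?uu//.
  exact: measurableT_comp mF measurable_fst.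
have -> : fine (Pr (band (L u))) = p.
  have := law (fun=> 1) (measurable_cst _).
  by rewrite /I !Rintegral_cst ?mul1r//; exact: measurable_band.
set c := << u, v >>.
have [b vE] : exists b, v = c *: u + b by exists (v - c *: u); rewrite addrC subrK.
have ub : << u, b >> = 0.
  have : c = c + << u, b >> by rewrite {1}/c {1}vE gramDr gramZr uu mulr1.
  by lra.
have bb : << b, b >> = << v, v >> - c ^+ 2.
  by rewrite vE gramDl !gramDr !gramZl !gramZr (gramC b u) ub uu; ring.
have mB := measurable_band u.
have [su sb] := (square_integrable_lin u, square_integrable_lin b).
have -> : Rintegral Pr (band (L u)) (fun w => L v w ^+ 2) =
    c ^+ 2 * I (fun w => L u0 w ^+ 2) + (<< v, v >> - c ^+ 2) * M.
  rewrite -(law (fun x => x ^+ 2))//.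
  rewrite -bb -(HM u b)// -[X in X + _]addr0.
  rewrite -(mulr0 (2 * c)) -(Rintegral_band_cross ub) -Rintegral_affine_sq//.
  by apply: eq_Rintegral => w _; rewrite [in LHS]vE linD linZ.
have -> : Rintegral Pr (band (L u)) (L v) = c * I (L u0).
  rewrite -(law id)// -[RHS]addr0 -(Rintegral_band_orthogonal ub) -Rintegral_affine//.
  by apply: eq_Rintegral => w _; have := linD (c *: u) b w; rewrite linZ -vE.
ring.
Qed.

End Band.
End Elliptical.

(** * The trace of the conditional covariance *)

Section Trace.
Context {R : realType} {dT : measure_display} {T : measurableType dT}.
Variables (Pr : probability T R) (n : nat) (X : T -> 'cV[R]_n.+1).
Variables (mu : 'cV[R]_n.+1) (Sigma : 'M[R]_n.+1) (phi_re phi_im : R -> R).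
Hypotheses (mX : is_random_vector X) (sX : finite_second_moments Pr X).
Hypothesis ellX : elliptical Pr X mu Sigma phi_re phi_im.
Hypothesis symSigma : Sigma^T = Sigma.
Hypothesis posSigma : forall v : 'cV[R]_n.+1, v != 0 -> 0 < gram Sigma v v.

Local Notation L := (lin X mu).
Local Notation "<< u , v >>" := (gram Sigma u v).

(** For positive definite [Sigma], this is the ordinary Rayleigh quotient of [Sigma] at the vector
    [Sigma^(1/2) a]. *)
Definition rayleigh (Sigma : 'M[R]_n.+1) (a : 'cV[R]_n.+1) : R :=
  gram (Sigma *m Sigma) a a / gram Sigma a a.

(** The diagonal entries are conditional variances of the coordinates of [P X], which differ from
    the centred forms by constants. *)
Lemma tr_cond_cov_mx (P : 'M[R]_n.+1) E : measurable E ->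
  \tr (cond_cov_mx Pr (fun w => P *m X w) E) =
  \sum_j cond_var Pr E (L (row j P)^T).
Proof.
move=> mE; apply: eq_bigr => j _.
rewrite mxE -(@cond_var_shift _ _ _ _ _ _ ((row j P *m mu) 0 0) mE); last first.
  exact: square_integrable_lin.
have cE w : L (row j P)^T w + (row j P *m mu) 0 0 = rv_coord (fun w => P *m X w) j w.
  by rewrite /lin trmxK mulmxBr mxE [X in _ + X + _]mxE subrK -row_mul mxE.
by rewrite /cond_var /cond_expect -expr2; congr (_ / _ - (_ / _) ^+ 2);
  apply: eq_Rintegral => w _; rewrite cE ?expr2.
Qed.

(** The summed entries are the coordinates of [P Sigma u], a vector of the same length as
    [Sigma u]. *)
Lemma sum_gram_row_sq (P : 'M[R]_n.+1) u : orthogonal_mx P ->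
  \sum_j << u, (row j P)^T >> ^+ 2 = gram (Sigma *m Sigma) u u.
Proof.
move=> /mulmx1C PP.
have -> : gram (Sigma *m Sigma) u u =
    ((P *m Sigma *m u)^T *m (P *m Sigma *m u)) 0 0.
  rewrite /gram !trmx_mul symSigma; congr (_ 0 0).
  by rewrite !mulmxA -(mulmxA _ P^T) PP mulmx1.
rewrite mxE; apply: eq_bigr => j _.
by rewrite gramC// /gram trmxK -!row_mul !mxE -expr2.
Qed.

(** The terms are the diagonal entries of [P Sigma P'], which is similar to [Sigma]. *)
Lemma sum_gram_row (P : 'M[R]_n.+1) : orthogonal_mx P ->
  \sum_j << (row j P)^T, (row j P)^T >> = \tr Sigma.
Proof.
move=> /mulmx1C PP.
have -> : \tr Sigma = \tr (P *m Sigma *m P^T).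
  by rewrite mxtrace_mulC mulmxA PP mul1mx.
apply: eq_bigr => j _.
by rewrite /gram trmxK -row_mul tr_row !mxE; apply: eq_bigr => k _; rewrite !mxE.
Qed.

Lemma normalize_gram a : a != 0 ->
  0 < Num.sqrt << a, a >> /\
  << (Num.sqrt << a, a >>)^-1 *: a, (Num.sqrt << a, a >>)^-1 *: a >> = 1.
Proof.
move=> /posSigma aa; have s0 : 0 < Num.sqrt << a, a >> by rewrite sqrtr_gt0.
split=> //; rewrite gramZl gramZr mulrA -invfM -expr2 sqr_sqrtr ?ltW//.
by rewrite mulVf// gt_eqF.
Qed.

Lemma orthogonal_row_neq0 (P : 'M[R]_n.+1) i : orthogonal_mx P -> (row i P)^T != 0.
Proof.
move=> PP; apply/eqP => r0.
have P0 k : P i k = 0.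
  by have := congr1 (fun A : 'cV[R]_n.+1 => A k 0) r0; rewrite !mxE.
have := congr1 (fun A : 'M[R]_n.+1 => A i i) PP; rewrite /= mxE [RHS]mxE eqxx.
rewrite big1 => [/eqP|k _]; last by rewrite P0 mul0r.
by rewrite eq_sym oner_eq0.
Qed.

(** [k] and [m] are computed from one reference direction and serve every [P] and [i]; only the
    quotient at row [i] still varies. *)
Lemma tr_cond_cov_central (alpha : R) : 0 < alpha < 1 ->
  exists k m, k <= m /\ forall P i, orthogonal_mx P ->
    \tr (cond_cov_mx Pr (fun w => P *m X w)
      (central_event Pr (rv_coord (fun w => P *m X w) i) alpha)) =
    m * \tr Sigma - (m - k) * rayleigh Sigma (row i P)^T.
Proof.
move=> /andP[a0 a1].
have o1 : orthogonal_mx (1%:M : 'M[R]_n.+1) by rewrite /orthogonal_mx trmx1 mulmx1.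
(* The reference direction is the normalised first row of the identity; it fixes the endpoints [q1]
   and [q2]. *)
have [_ u00] := normalize_gram (orthogonal_row_neq0 0 o1).
set u0 := (_ *: _) in u00.
have mL := measurable_lin mu mX sX.
pose q1 := quantile Pr (L u0) (alpha / 2).
pose q2 := quantile Pr (L u0) (1 - alpha / 2).
have symu0 := lin_symmetric mX sX ellX symSigma u0.
have q1_le0 : q1 <= 0 by apply: quantile_le0 => //; lra.
have q2_ge0 : 0 <= q2 by apply: quantile_ge0 => //; lra.
have psd v : 0 <= << v, v >>.
  have [->|/posSigma/ltW//] := eqVneq v 0.
  by rewrite /gram mulmx0 mxE.
have [k [m [km H]]] := cond_var_band mX sX ellX symSigma q1_le0 q2_ge0 psd u00.
exists k, m; split=> // P i PP.
have [s0 uu] := normalize_gram (orthogonal_row_neq0 i PP).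
set a := (row i P)^T in s0 uu *; set s := Num.sqrt _ in s0 uu *.
set u := s^-1 *: a in uu *.
(* Undoing the normalisation exhibits the conditioned coordinate as an increasing affine function of
   [L u], so its central event is the band between [q1] and [q2]. *)
have rvE : rv_coord (fun w => P *m X w) i = fun w => s * L u w + (a^T *m mu) 0 0.
  apply/funext => w; rewrite /u linZ mulrA divff ?gt_eqF// mul1r.
  by rewrite /lin mulmxBr mxE [X in _ + X + _]mxE subrK trmxK -row_mul mxE.
have -> : central_event Pr (rv_coord (fun w => P *m X w) i) alpha = band q1 q2 (L u).
  rewrite /central_event rvE !quantile_affine//; [|lra..].
  rewrite (@quantile_lin _ _ _ _ _ _ _ _ _ _ mX sX ellX symSigma u u0) ?uu ?u00//.
  rewrite (@quantile_lin _ _ _ _ _ _ _ _ _ _ mX sX ellX symSigma u u0) ?uu ?u00//.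
  by apply/seteqP; split=> w /=; rewrite !lerD2r !ler_pM2l.
rewrite tr_cond_cov_mx; last exact: measurable_band.
under eq_bigr do rewrite H//.
rewrite big_split/= -!mulr_suml sumrB sum_gram_row// sum_gram_row_sq//.
have -> : gram (Sigma *m Sigma) u u = rayleigh Sigma a.
  rewrite /rayleigh /u gramZl gramZr mulrA -invfM -expr2 sqr_sqrtr ?psd//.
  by rewrite mulrC.
ring.
Qed.

End Trace.

(** * Rayleigh-type quotients *)

Section Spectral.
Context {R : realType} (n : nat).
Variables (V : 'M[R]_n.+1) (lam : 'I_n.+1 -> R).
Hypothesis oV : orthogonal_mx V.
Hypothesis lam_noninc : forall i j : 'I_n.+1, (i <= j)%N -> lam j <= lam i.
Hypothesis lam_gt0 : forall i, 0 < lam i.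

Local Notation Sigma := (V *m diag_mx (\row_j lam j) *m V^T).

Lemma gram_diag (d : 'rV[R]_n.+1) (a : 'cV[R]_n.+1) :
  gram (V *m diag_mx d *m V^T) a a = \sum_j d 0 j * (V^T *m a) j 0 ^+ 2.
Proof.
have -> : gram (V *m diag_mx d *m V^T) a a =
    ((V^T *m a)^T *m (diag_mx d *m (V^T *m a))) 0 0.
  by rewrite /gram trmx_mul trmxK !mulmxA.
rewrite mxE; apply: eq_bigr => j _.
by rewrite mul_diag_mx ![in LHS]mxE mulrCA -expr2 [in RHS]mxE.
Qed.

Lemma gram_spectral a : gram Sigma a a = \sum_j lam j * (V^T *m a) j 0 ^+ 2.
Proof. by rewrite gram_diag; apply: eq_bigr => j _; rewrite mxE. Qed.

Lemma gram_spectral_sq a :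
  gram (Sigma *m Sigma) a a = \sum_j lam j ^+ 2 * (V^T *m a) j 0 ^+ 2.
Proof.
have -> : Sigma *m Sigma = V *m diag_mx (\row_j (lam j ^+ 2)) *m V^T.
  rewrite !mulmxA -(mulmxA _ V^T) (mulmx1C oV) mulmx1 -(mulmxA V) mulmx_diag.
  by congr (V *m diag_mx _ *m _); apply/rowP => j; rewrite !mxE.
by rewrite gram_diag; apply: eq_bigr => j _; rewrite mxE.
Qed.

Lemma spectral_sym : Sigma^T = Sigma.
Proof. by rewrite !trmx_mul trmxK tr_diag_mx mulmxA. Qed.

Lemma spectral_posdef (a : 'cV[R]_n.+1) : a != 0 -> 0 < gram Sigma a a.
Proof.
move=> a0; rewrite gram_spectral.
have ge0 j : 0 <= lam j * (V^T *m a) j 0 ^+ 2 by rewrite mulr_ge0 ?sqr_ge0// ltW.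
rewrite lt_neqAle sumr_ge0 ?andbT// eq_sym; apply: contra a0.
rewrite psumr_eq0// => /allP y0; rewrite -[a]mul1mx -oV -mulmxA.
suff -> : V^T *m a = 0 by rewrite mulmx0.
apply/colP => j; have := y0 j (mem_index_enum j).
by rewrite mulf_eq0 gt_eqF//= expf_eq0 /= => /eqP ->; rewrite mxE.
Qed.

(** After clearing the denominator both bounds hold term by term, from
    [lam ord_max <= lam j <= lam ord0] multiplied by [lam j]. *)
Lemma rayleigh_bounds (a : 'cV[R]_n.+1) : a != 0 ->
  lam ord_max <= rayleigh Sigma a <= lam ord0.
Proof.
move=> /spectral_posdef s0; rewrite /rayleigh ler_pdivlMr// ler_pdivrMr//.
rewrite gram_spectral_sq gram_spectral !mulr_sumr.
have le_mul j c y : lam j <= c -> lam j ^+ 2 * y ^+ 2 <= c * (lam j * y ^+ 2).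
  move=> jc; rewrite (mulrA c) ler_wpM2r ?sqr_ge0// expr2.
  by rewrite ler_wpM2r// ltW.
have ge_mul j c y : c <= lam j -> c * (lam j * y ^+ 2) <= lam j ^+ 2 * y ^+ 2.
  move=> jc; rewrite (mulrA c) ler_wpM2r ?sqr_ge0// expr2.
  by rewrite ler_wpM2r// ltW.
apply/andP; split; apply: ler_sum => j _.
  by apply: ge_mul; apply: lam_noninc; rewrite -ltnS ltn_ord.
by apply: le_mul; exact: lam_noninc.
Qed.

(** In the eigenbasis [col k V] is the [k]-th unit vector, so the quotient is
    [lam k ^+ 2 / lam k]. *)
Lemma rayleigh_eigenvector k : rayleigh Sigma (col k V) = lam k.
Proof.
have yE j : (V^T *m col k V) j 0 = (j == k)%:R.
  have := congr1 (fun A : 'M[R]_n.+1 => A j k) (mulmx1C oV).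
  by rewrite /= mxE [RHS]mxE => <-; rewrite mxE; apply: eq_bigr => l _; rewrite !mxE.
have sumE F : \sum_j F j * (V^T *m col k V) j 0 ^+ 2 = F k.
  rewrite (bigD1 k)//= yE eqxx expr1n mulr1 big1 ?addr0// => j /negbTE jk.
  by rewrite yE jk expr0n mulr0.
rewrite /rayleigh gram_spectral_sq gram_spectral (sumE lam) (sumE (fun j => lam j ^+ 2)).
by rewrite expr2 mulfK// gt_eqF.
Qed.

End Spectral.

(** * Extremal orthogonal matrices *)

Lemma orthogonal_xrow (R : realType) (n : nat) (i j : 'I_n) (P : 'M[R]_n) :
  orthogonal_mx P -> orthogonal_mx (xrow i j P).
Proof.
rewrite /orthogonal_mx xrowE => PP; rewrite trmx_mul mulmxA -(mulmxA _ P) PP mulmx1.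
by rewrite tr_tperm_mx -perm_mxM perm.tperm2 perm_mx1.
Qed.

Unset Implicit Arguments.
Set Strict Implicit.

Theorem theorem8 (R : realType) (dT : measure_display) (T : measurableType dT)
  (Pr : probability T R) (n : nat) (X : T -> 'cV[R]_n.+1)
  (mu : 'cV[R]_n.+1) (Sigma : 'M[R]_n.+1) (phi_re phi_im : R -> R)
  (V : 'M[R]_n.+1) (lam : 'I_n.+1 -> R) (alpha : R) :
  is_random_vector X ->
  finite_second_moments Pr X ->
  elliptical Pr X mu Sigma phi_re phi_im ->
  cov_mx Pr X = Sigma ->
  orthogonal_mx V ->
  Sigma = V *m diag_mx (\row_j lam j) *m V^T ->
  (forall i j : 'I_n.+1, (i <= j)%N -> lam j <= lam i) ->
  (forall i, 0 < lam i) ->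
  0 < alpha < 1 ->
  let Y := fun w => V^T *m X w in
  let trcov := fun P : 'M[R]_n.+1 => fun i : 'I_n.+1 =>
    \tr (cond_cov_mx Pr (fun w => P *m X w)
          (central_event Pr (rv_coord (fun w => P *m X w) i) alpha)) in
  forall i : 'I_n.+1,
    (* maximum over orthogonal P *)
    ((exists2 P, orthogonal_mx P &
        trcov P i = \tr (cond_cov_mx Pr Y (central_event Pr (rv_coord Y ord_max) alpha)))
     /\ forall P, orthogonal_mx P ->
        trcov P i <= \tr (cond_cov_mx Pr Y (central_event Pr (rv_coord Y ord_max) alpha)))
    /\
    (* minimum over orthogonal P *)
    ((exists2 P, orthogonal_mx P &
        trcov P i = \tr (cond_cov_mx Pr Y (central_event Pr (rv_coord Y ord0) alpha)))
     /\ forall P, orthogonal_mx P ->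
        \tr (cond_cov_mx Pr Y (central_event Pr (rv_coord Y ord0) alpha)) <= trcov P i).
Proof.
move=> mX sX ellX _ oV SigmaE lam_noninc lam_gt0 a01 Y trcov i.
have symSigma : Sigma^T = Sigma by rewrite SigmaE spectral_sym.
have posSigma (v : 'cV[R]_n.+1) : v != 0 -> 0 < gram Sigma v v.
  by rewrite SigmaE; exact: spectral_posdef.
have [k [m [km trE]]] := tr_cond_cov_central mX sX ellX symSigma posSigma a01.
have oVT : orthogonal_mx V^T by rewrite /orthogonal_mx trmxK; exact: mulmx1C.
(* [Y] is the case [P = V'], whose row [l] is the eigenvector for [lam l]. *)
have YE l : \tr (cond_cov_mx Pr Y (central_event Pr (rv_coord Y l) alpha)) =
    m * \tr Sigma - (m - k) * lam l.
  by rewrite trE// tr_row trmxK SigmaE rayleigh_eigenvector.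
have attained l : exists2 P, orthogonal_mx P &
    trcov P i = \tr (cond_cov_mx Pr Y (central_event Pr (rv_coord Y l) alpha)).
  (* Exchanging rows [i] and [l] of [V'] puts the required eigenvector in the conditioned position,
     and the trace depends on [P] only through that row. *)
  exists (xrow i l V^T); first exact: orthogonal_xrow.
  rewrite /trcov !trE//; last exact: orthogonal_xrow.
  suff -> : row i (xrow i l V^T) = row l V^T by [].
  by apply/rowP => j; rewrite !mxE perm.tpermL.
have bounds P : orthogonal_mx P ->
    lam ord_max <= rayleigh Sigma (row i P)^T <= lam ord0.
  by move=> oP; rewrite SigmaE; apply: rayleigh_bounds => //; exact: orthogonal_row_neq0.
(* As [m - k >= 0], the trace is antitone in the quotient: the least eigenvalue gives the maximum
   and the greatest gives the minimum. *)
by split; split=> [|P oP]; [exact: attained | | exact: attained |];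
  rewrite YE /trcov trE// lerD2l lerN2 ler_wpM2l ?subr_ge0//;
  have /andP[] := bounds P oP.
Qed.
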